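(* Let $R$ be a reduced (commutative noetherian) ring of dimension $1$. Then there is a generator $M$ giving a noncommutative resolution $\operatorname{End}_R(M)$ of $R$ of global dimension $1$ if and only if $R$ is regular.
   Context: For a finitely generated $R$-module $M$, $\operatorname{add} M$ is the category of direct summands of finite direct sums of copies of $M$; $M$ is a generator if $R \in \operatorname{add} M$. A finitely generated $R$-module $M$ gives a noncommutative resolution (NCR) of $R$ if $\operatorname{supp} M =\operatorname{supp} R$ and $\operatorname{End}_R(M)$ has finite global dimension. *)

(* Defs.v *)
From HB Require Import structures.
From mathcomp Require Import all_boot all_algebra.
From mathcomp Require Import ring_quotient generic_quotient boolp ring.

Set Implicit Arguments.
Unset Strict Implicit.
Unset Printing Implicit Defensive.

Import GRing.Theory.

Local Open Scope ring_scope.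
Local Open Scope quotient_scope.

Section Modules.
Variable A : pzRingType.
Implicit Types M N P : lmodType A.

Definition finitely_generated M : Prop :=
  exists (n : nat) (g : 'I_n -> M),
    forall x, exists c : 'I_n -> A, x = \sum_(i < n) c i *: g i.

(* Some N (+) N' is isomorphic to M^n. *)
Definition in_add M N : Prop :=
  exists (n : nat) (N' : lmodType A)
         (f : {linear (N * N')%type -> {ffun 'I_n -> M}}), bijective f.

Definition generator M : Prop := in_add M A^o.

Definition surj (T U : Type) (f : T -> U) : Prop := forall y, exists x, f x = y.

Definition projective P : Prop :=
  forall (X Y : lmodType A) (g : {linear X -> Y}) (f : {linear P -> Y}),
    surj g -> exists h : {linear P -> X}, forall x, g (h x) = f x.

(* M has a projective resolution of length at most n:
   0 -> P_n -> ... -> P_1 -> P_0 -> M -> 0. *)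
Definition proj_dim_le (n : nat) M : Prop :=
  exists (P : nat -> lmodType A) (d : forall i, {linear P i.+1 -> P i})
         (e : {linear P 0%N -> M}),
    [/\ forall i, projective (P i),
        forall i, (n < i)%N -> forall x : P i, x = 0,
        surj e,
        forall x, e x = 0 <-> exists y, d 0%N y = x
      & forall i x, d i x = 0 <-> exists y, d i.+1 y = x].

End Modules.

(* Computed with left A-modules; replacing A by A^c gives the global dimension
   computed with right A-modules. *)
Definition gldim_le (A : pzRingType) (n : nat) : Prop :=
  forall M : lmodType A, proj_dim_le n M.

Definition gldim_eq (A : pzRingType) (n : nat) : Prop :=
  gldim_le A n /\ forall m, gldim_le A m -> (n <= m)%N.

Definition finite_gldim (A : pzRingType) : Prop := exists n, gldim_le A n.

Section EndomorphismRing.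
Variables (R : comPzRingType) (M : lmodType R).

Definition endo : Type := {linear M -> M}.

HB.instance Definition _ := gen_eqMixin endo.
HB.instance Definition _ := gen_choiceMixin endo.

Implicit Types f g h : endo.

Lemma endoP f g : (forall x, f x = g x) -> f = g.
Proof.
case: f g => [f [[a] [b]]] [g [[a'] [b']]] /= /funext fg; subst g.
by rewrite (Prop_irrelevance a a') (Prop_irrelevance b b').
Qed.

Definition endo_zero : endo := \0 : {linear M -> M}.
Definition endo_opp f : endo := \- f : {linear M -> M}.
Definition endo_add f g : endo := f \+ g : {linear M -> M}.
Definition endo_one : endo := idfun : {linear M -> M}.
Definition endo_mul f g : endo := f \o g : {linear M -> M}.

Fact endo_addA : associative endo_add.
Proof. by move=> f g h; apply: endoP => x /=; rewrite addrA. Qed.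
Fact endo_addC : commutative endo_add.
Proof. by move=> f g; apply: endoP => x /=; rewrite addrC. Qed.
Fact endo_add0 : left_id endo_zero endo_add.
Proof. by move=> f; apply: endoP => x /=; rewrite add0r. Qed.
Fact endo_addN : left_inverse endo_zero endo_opp endo_add.
Proof. by move=> f; apply: endoP => x /=; rewrite addNr. Qed.

HB.instance Definition _ :=
  GRing.isZmodule.Build endo endo_addA endo_addC endo_add0 endo_addN.

Fact endo_mulA : associative endo_mul.
Proof. by move=> f g h; apply: endoP. Qed.
Fact endo_mul1l : left_id endo_one endo_mul.
Proof. by move=> f; apply: endoP. Qed.
Fact endo_mul1r : right_id endo_one endo_mul.
Proof. by move=> f; apply: endoP. Qed.
Fact endo_mulDl : left_distributive endo_mul +%R.
Proof. by move=> f g h; apply: endoP. Qed.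
Fact endo_mulDr : right_distributive endo_mul +%R.
Proof. by move=> f g h; apply: endoP => x /=; rewrite raddfD. Qed.

HB.instance Definition _ := GRing.Zmodule_isPzRing.Build endo
  endo_mulA endo_mul1l endo_mul1r endo_mulDl endo_mulDr.

End EndomorphismRing.

Section Localization.
Variables (R : comNzRingType) (p : prime_idealr R).

Record denom := Denom { den : R; denP : den \notin p }.
HB.instance Definition _ := [isSub for den].
HB.instance Definition _ := [Choice of denom by <:].

Implicit Types s t u : denom.

Fact denom1_subproof : 1 \notin p.
Proof. by rewrite idealr1. Qed.
Definition denom1 : denom := Denom denom1_subproof.

Fact denomM_subproof s t : den s * den t \notin p.
Proof. by rewrite prime_idealrM negb_or !denP. Qed.
Definition denomM s t : denom := Denom (denomM_subproof s t).

Section LocalizedModule.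
Variable M : lmodType R.
Implicit Types x y z : M * denom.

(* m / s = m' / s' iff u (s' m - s m') = 0 for some u outside p. *)
Definition loc_rel x y : bool :=
  `[< exists u : denom,
        den u *: (den y.2 *: x.1) = den u *: (den x.2 *: y.1) >].

Fact loc_rel_refl : reflexive loc_rel.
Proof. by move=> x; apply/asboolP; exists denom1. Qed.

Fact loc_rel_sym : symmetric loc_rel.
Proof. by move=> x y; apply/asboolP/asboolP => -[u e]; exists u. Qed.

Fact loc_rel_trans : transitive loc_rel.
Proof.
move=> y x z /asboolP[u e] /asboolP[v e']; apply/asboolP.
exists (denomM (denomM u v) y.2) => /=.
transitivity ((den v * den z.2) *: (den u *: (den y.2 *: x.1))).
  by rewrite !scalerA; congr (_ *: _); ring.
transitivity ((den u * den x.2) *: (den v *: (den z.2 *: y.1))).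
  by rewrite e !scalerA; congr (_ *: _); ring.
by rewrite e' !scalerA; congr (_ *: _); ring.
Qed.

Canonical loc_equiv := EquivRel loc_rel loc_rel_refl loc_rel_sym loc_rel_trans.

Definition locmod := {eq_quot loc_equiv}.
HB.instance Definition _ : EqQuotient _ loc_equiv locmod :=
  EqQuotient.on locmod.
HB.instance Definition _ := Choice.on locmod.

Definition frac (m : M) (s : denom) : locmod := \pi_locmod (m, s).

Lemma fracP (w : locmod) : exists m s, w = frac m s.
Proof. by exists (repr w).1, (repr w).2; rewrite /frac -surjective_pairing reprK. Qed.

Lemma fracE m s m' s' : frac m s = frac m' s' <->
  exists u : denom, den u *: (den s' *: m) = den u *: (den s *: m').
Proof. by split=> [/eqquotP/asboolP|?]; [|apply/eqquotP/asboolP]. Qed.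

Lemma frac_eq m s m' s' : den s' *: m = den s *: m' -> frac m s = frac m' s'.
Proof. by move=> e; apply/fracE; exists denom1; rewrite e. Qed.

Definition loc_zero : locmod := frac 0 denom1.
Definition loc_opp (w : locmod) : locmod := frac (- (repr w).1) (repr w).2.
Definition loc_add (w w' : locmod) : locmod :=
  frac (den (repr w').2 *: (repr w).1 + den (repr w).2 *: (repr w').1)
       (denomM (repr w).2 (repr w').2).

Lemma repr_frac m s : exists u : denom,
  den u *: (den s *: (repr (frac m s)).1) = den u *: (den (repr (frac m s)).2 *: m).
Proof. by apply/fracE; rewrite /frac -surjective_pairing reprK. Qed.

Lemma loc_oppE m s : loc_opp (frac m s) = frac (- m) s.
Proof.
have [u e] := repr_frac m s; apply/fracE; exists u.
by rewrite !scalerN e.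
Qed.

Lemma loc_addE m s m' s' : loc_add (frac m s) (frac m' s') =
  frac (den s' *: m + den s *: m') (denomM s s').
Proof.
have [u e] := repr_frac m s; have [v e'] := repr_frac m' s'.
rewrite /loc_add; case: (repr (frac m s)) e => a b /= e.
case: (repr (frac m' s')) e' => a' b' /= e'.
apply/fracE; exists (denomM u v); rewrite !scalerDr /=; congr (_ + _).
  transitivity ((den v * den s' * den b') *: (den u *: (den s *: a))).
    by rewrite !scalerA; congr (_ *: _); ring.
  by rewrite e !scalerA; congr (_ *: _); ring.
transitivity ((den u * den s * den b) *: (den v *: (den s' *: a'))).
  by rewrite !scalerA; congr (_ *: _); ring.
by rewrite e' !scalerA; congr (_ *: _); ring.
Qed.

Fact loc_addA : associative loc_add.
Proof.
move=> w1 w2 w3; have [m1 [s1 ->]] := fracP w1; have [m2 [s2 ->]] := fracP w2.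
have [m3 [s3 ->]] := fracP w3; rewrite !loc_addE; apply: frac_eq => /=.
rewrite !scalerDr !scalerA addrA.
by congr (_ *: _ + _ *: _ + _ *: _); ring.
Qed.

Fact loc_addC : commutative loc_add.
Proof.
move=> w1 w2; have [m1 [s1 ->]] := fracP w1; have [m2 [s2 ->]] := fracP w2.
rewrite !loc_addE; apply: frac_eq => /=.
by rewrite addrC; congr (_ *: _); ring.
Qed.

Fact loc_add0 : left_id loc_zero loc_add.
Proof.
move=> w; have [m [s ->]] := fracP w; rewrite loc_addE; apply: frac_eq => /=.
by rewrite scaler0 add0r !scalerA; congr (_ *: _); ring.
Qed.

Fact loc_addN : left_inverse loc_zero loc_opp loc_add.
Proof.
move=> w; have [m [s ->]] := fracP w; rewrite loc_oppE loc_addE.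
by apply: frac_eq => /=; rewrite scalerN addNr !scaler0.
Qed.

HB.instance Definition _ :=
  GRing.isZmodule.Build locmod loc_addA loc_addC loc_add0 loc_addN.

End LocalizedModule.

(* The local ring R_p: the localization of R as a module over itself, with the
   multiplication of fractions. *)
Definition locring : Type := locmod R^o.
HB.instance Definition _ := GRing.Zmodule.on locring.

Definition rfrac (a : R) (s : denom) : locring := frac (a : R^o) s.

Definition loc_one : locring := rfrac 1 denom1.
Definition loc_mul (w w' : locring) : locring :=
  rfrac ((repr w).1 * (repr w').1) (denomM (repr w).2 (repr w').2).

Lemma rfracD a s a' s' :
  rfrac a s + rfrac a' s' = rfrac (den s' * a + den s * a') (denomM s s').
Proof. exact: loc_addE. Qed.

Lemma loc_mulE a s a' s' :
  loc_mul (rfrac a s) (rfrac a' s') = rfrac (a * a') (denomM s s').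
Proof.
have [u e] := repr_frac (a : R^o) s; have [v e'] := repr_frac (a' : R^o) s'.
rewrite /loc_mul /rfrac; case: (repr (frac (a : R^o) s)) e => b t /= e.
case: (repr (frac (a' : R^o) s')) e' => b' t' /= e'.
rewrite /GRing.scale /= in e e'.
apply/fracE; exists (denomM u v); rewrite /GRing.scale /=.
transitivity ((den u * (den s * b)) * (den v * (den s' * b'))); first by ring.
by rewrite e e'; ring.
Qed.

Lemma rfrac_eq a s a' s' : den s' * a = den s * a' -> rfrac a s = rfrac a' s'.
Proof. by move=> e; apply: (@frac_eq R^o). Qed.

Fact loc_mulA : associative loc_mul.
Proof.
move=> w1 w2 w3; have [a [s ->]] := fracP w1; have [b [t ->]] := fracP w2.
have [c [u ->]] := fracP w3; rewrite -!/(rfrac _ _) !loc_mulE.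
by apply: rfrac_eq => /=; ring.
Qed.

Fact loc_mulC : commutative loc_mul.
Proof.
move=> w1 w2; have [a [s ->]] := fracP w1; have [b [t ->]] := fracP w2.
by rewrite -!/(rfrac _ _) !loc_mulE; apply: rfrac_eq => /=; ring.
Qed.

Fact loc_mul1 : left_id loc_one loc_mul.
Proof.
move=> w; have [a [s ->]] := fracP w; rewrite -!/(rfrac _ _) loc_mulE.
by apply: rfrac_eq => /=; ring.
Qed.

Fact loc_mulDl : left_distributive loc_mul +%R.
Proof.
move=> w1 w2 w3; have [a [s ->]] := fracP w1; have [b [t ->]] := fracP w2.
have [c [u ->]] := fracP w3.
rewrite -!/(rfrac _ _) rfracD !loc_mulE rfracD.
by apply: rfrac_eq => /=; ring.
Qed.

Fact loc_one_neq0 : loc_one != 0.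
Proof.
apply/eqP => /fracE[u]; rewrite /GRing.scale /= !mulr1 !mulr0 => u0.
by have /negP[] := denP u; rewrite (u0 : den u = 0 :> R) idealr0.
Qed.

HB.instance Definition _ := GRing.Zmodule_isComNzRing.Build locring
  loc_mulA loc_mulC loc_mul1 loc_mulDl loc_one_neq0.

End Localization.

Definition in_supp (R : comNzRingType) (M : lmodType R) (p : prime_idealr R) :
    Prop :=
  exists w : locmod p M, w <> 0.

Section CommutativeRings.
Variable R : comNzRingType.

Definition reduced : Prop := forall (x : R) (n : nat), x ^+ n = 0 -> x = 0.

Definition generated_by (I : {pred R}) (n : nat) (g : 'I_n -> R) : Prop :=
  forall x, x \in I <-> exists c : 'I_n -> R, x = \sum_(i < n) c i * g i.

(* Ideals of R (possibly improper) are the submodules of R^o. *)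
Definition noetherian : Prop :=
  forall I : {pred R}, submod_closed (I : {pred R^o}) ->
    exists (n : nat) (g : 'I_n -> R), generated_by I g.

(* Only p 0, ..., p n are constrained: a chain of length n has n inclusions. *)
Definition prime_chain (n : nat) (p : nat -> prime_idealr R) : Prop :=
  forall i, (i < n)%N ->
    {subset p i <= p i.+1} /\ ~ {subset p i.+1 <= p i}.

Definition krull_dim_eq (n : nat) : Prop :=
  (exists p, prime_chain n p) /\ forall k p, prime_chain k p -> (k <= n)%N.

(* Elements of type idealr R are proper ideals. *)
Definition maximal_ideal (m : idealr R) : Prop :=
  forall I : idealr R, {subset m <= I} -> {subset I <= m}.

Definition unique_maximal_ideal (m : idealr R) : Prop :=
  maximal_ideal m /\ forall I : idealr R, maximal_ideal I -> I =i m.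

Definition regular_local : Prop :=
  noetherian /\
  exists (m : idealr R) (d : nat) (g : 'I_d -> R),
    [/\ unique_maximal_ideal m, krull_dim_eq d & generated_by m g].

End CommutativeRings.

Definition regular (R : comNzRingType) : Prop :=
  noetherian R /\ forall p : prime_idealr R, regular_local (locring p).

(* The global dimension of End_R(M) is computed with right modules, the target
   category of Hom_R(M, -).  As End_R(M) is finite over R it is noetherian on
   both sides when R is noetherian, so left modules give the same value. *)
Definition gives_NCR (R : comNzRingType) (M : lmodType R) : Prop :=
  [/\ finitely_generated M,
      forall p : prime_idealr R, in_supp M p <-> in_supp R^o p
    & finite_gldim (endo M)^c].

(* Main.v *)
(** If Lambda = End(M) has global dimension at most 1, then for every ideal I of
    R the right ideal I Lambda has a dual basis over Lambda (Schanuel), and since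
    M is a generator the trace pairing M^* x M -> R is onto, so that this dual
    basis descends to I.  Hence all ideals of R are projective; locally this makes
    R_p a domain whose maximal ideal is principal.

    Conversely, take M = R.  If R is regular of dimension 1, the nonzero ideals
    of each R_p are generated by a power of a uniformizer, so ideals of R are
    projective, and Kaplansky's theorem on submodules of free modules over a
    hereditary ring bounds the global dimension by 1.  It is not 0, because R/p1 is
    not projective when p0 < p1 is a strict inclusion of primes. *)
From mathcomp Require Import functions.
Require Import Defs.
From HB Require Import structures.
From mathcomp Require Import all_boot all_algebra.
From mathcomp Require Import ring_quotient generic_quotient boolp ring.
From mathcomp Require classical_sets.

Set Implicit Arguments.
Unset Strict Implicit.
Unset Printing Implicit Defensive.

Import GRing.Theory.
Local Open Scope ring_scope.
Local Open Scope quotient_scope.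

(** * Submodules, quotients and linear maps *)

Section LinearMaps.
Variables (A : pzRingType) (U V : lmodType A).

Definition mk_linear (f : U -> V) (lin_f : linear f) : {linear U -> V} :=
  HB.pack f (GRing.isLinear.Build A U V *:%R f lin_f).

Lemma mk_linearE f lin_f x : @mk_linear f lin_f x = f x.
Proof. by []. Qed.

(** The difference of two values at one point is a value at 0, hence 0, so the graph is
    single-valued. Zorn's lemma below produces graphs rather than functions. *)
Lemma linear_of_graph (G : U -> V -> Prop) :
    (forall x, exists y, G x y) -> (forall y, G 0 y -> y = 0) ->
    (forall a x x' y y', G x y -> G x' y' -> G (a *: x + x') (a *: y + y')) ->
  exists h : {linear U -> V}, forall x, G x (h x).
Proof.
move=> /choice[h hG] G0 GD.
have Gfun x y y' : G x y -> G x y' -> y = y'.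
  move=> Gy Gy'; apply/eqP; rewrite -subr_eq0; apply/eqP/G0.
  by have := GD (- 1) _ _ _ _ Gy' Gy; rewrite !scaleN1r addNr addrC.
have lin_h : linear h by move=> a x x'; apply: (Gfun (a *: x + x')); auto.
by exists (mk_linear lin_h).
Qed.

End LinearMaps.

Record submodule (A : pzRingType) (U : lmodType A) (S : {pred U})
  (clS : submod_closed S) : Type :=
  Submodule { submodule_val : U; _ : submodule_val \in S }.

Section Submodule.
Variables (A : pzRingType) (U : lmodType A) (S : {pred U}) (clS : submod_closed S).

HB.instance Definition _ := [isSub for @submodule_val A U S clS].
HB.instance Definition _ := [Choice of submodule clS by <:].
HB.instance Definition _ :=
  GRing.SubChoice_isSubLmodule.Build A U S (submodule clS) clS.

End Submodule.

Section QuotientModule.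
Variables (A : pzRingType) (U : lmodType A) (S : {pred U}) (clS : submod_closed S).

Let zS : zmodClosed U :=
  HB.pack_for (zmodClosed U) (S : U -> bool)
    (GRing.isZmodClosed.Build U S (GRing.submod_closedB clS)).

Definition quotient_module : Type := Quotient.quot zS.
HB.instance Definition _ := GRing.Zmodule.on quotient_module.

Definition quotient_map (x : U) : quotient_module := \pi_(Quotient.quot zS) x.

Lemma quotient_mapB x y : quotient_map (x - y) = quotient_map x - quotient_map y.
Proof. exact: raddfB. Qed.

Lemma quotient_map_eq0 x : quotient_map x = 0 <-> x \in S.
Proof.
have := Quotient.idealrBE zS x 0; rewrite subr0 => ->.
by rewrite -(raddf0 (\pi_(Quotient.quot zS))); split=> /eqP.
Qed.

Lemma quotient_mapP w : exists x, quotient_map x = w.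
Proof. by exists (repr w); apply: reprK. Qed.

Definition quotient_scale (a : A) (w : quotient_module) : quotient_module :=
  quotient_map (a *: repr w).

Lemma quotient_scaleE a x : quotient_scale a (quotient_map x) = quotient_map (a *: x).
Proof.
apply/eqP; rewrite -subr_eq0 -quotient_mapB -scalerBr; apply/eqP/quotient_map_eq0.
rewrite -[_ *: _]addr0; apply: clS.2 clS.1; apply/quotient_map_eq0; rewrite quotient_mapB.
by rewrite [quotient_map (repr _)]reprK subrr.
Qed.

Lemma quotient_mapD x y : quotient_map (x + y) = quotient_map x + quotient_map y.
Proof. exact: raddfD. Qed.

Fact quotient_scaleA a b w :
  quotient_scale a (quotient_scale b w) = quotient_scale (a * b) w.
Proof. by have [x <-] := quotient_mapP w; rewrite !quotient_scaleE scalerA. Qed.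

Fact quotient_scale1 : left_id 1 quotient_scale.
Proof. by move=> w; have [x <-] := quotient_mapP w; rewrite quotient_scaleE scale1r. Qed.

Fact quotient_scaleDr : right_distributive quotient_scale +%R.
Proof.
move=> a w w'; have [[x <-] [y <-]] := (quotient_mapP w, quotient_mapP w').
by rewrite -quotient_mapD !quotient_scaleE scalerDr quotient_mapD.
Qed.

Fact quotient_scaleDl w : {morph quotient_scale^~ w : a b / a + b}.
Proof.
move=> a b; have [x <-] := quotient_mapP w.
by rewrite !quotient_scaleE scalerDl quotient_mapD.
Qed.

HB.instance Definition _ := GRing.Zmodule_isLmodule.Build A quotient_module
  quotient_scaleA quotient_scale1 quotient_scaleDr quotient_scaleDl.

Fact quotient_map_linear : linear quotient_map.
Proof. by move=> a x y; rewrite quotient_mapD -quotient_scaleE. Qed.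

HB.instance Definition _ := GRing.isLinear.Build A U quotient_module *:%R
  quotient_map quotient_map_linear.

End QuotientModule.

(** * Hereditary rings *)

Section Hereditary.
Variable A : pzRingType.

(** [s] is total on [U], with arbitrary values off [L]; this avoids maps out of a subtype. *)
Definition linear_on (U V : lmodType A) (L : {pred U}) (s : U -> V) : Prop :=
  forall a, {in L &, forall x y, s (a *: x + y) = a *: s x + s y}.

(* By the dual basis lemma, L is then projective as soon as it is a submodule. *)
Definition dual_basis (U : lmodType A) (L : {pred U}) : Prop :=
  exists (I : finType) (s : I -> U -> A) (g : I -> U),
    [/\ forall i, @linear_on U A^o L (s i), forall i, g i \in L
      & {in L, forall x, x = \sum_i s i x *: g i}].

(** The index type of [dual_basis] is finite, so left ideals are finitely generated as well as
    projective. *)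
Definition hereditary : Prop :=
  forall L : {pred A^o}, submod_closed L -> dual_basis L.

Lemma linear_on0 (U V : lmodType A) (L : {pred U}) (s : U -> V) :
  0 \in L -> linear_on L s -> s 0 = 0.
Proof. by move=> L0 /(_ (-1) 0 0 L0 L0); rewrite scaler0 addr0 scaleN1r addNr. Qed.

Lemma linear_onZ (U V : lmodType A) (L : {pred U}) (s : U -> V) a x :
  0 \in L -> linear_on L s -> x \in L -> s (a *: x) = a *: s x.
Proof.
move=> L0 s_lin xL.
by have := s_lin a x 0 xL L0; rewrite (linear_on0 L0 s_lin) !addr0.
Qed.

(** * Kaplansky's theorem on submodules of free modules *)

Section Kaplansky.
Hypothesis hA : hereditary.
(** [co] embeds [K] into the free module on [I], so [K] stands for an arbitrary submodule of a free
    module. *)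
Variables (K : lmodType A) (I : choiceType) (co : K -> I -> A^o).
Hypothesis co_linear : forall i, linear (co^~ i).
Hypothesis co_inj : forall x, (forall i, co x i = 0) -> x = 0.
Hypothesis co_finite : forall x, exists s : seq I, forall i, i \notin s -> co x i = 0.

Let co0 i : co 0 i = 0.
Proof. exact: (linear0 (mk_linear (co_linear i))). Qed.

Let coB x y i : co (x - y) i = co x i - co y i.
Proof. exact: (linearB (mk_linear (co_linear i))). Qed.

Let co_sum (J : finType) (c : J -> A) (x : J -> K) i :
  co (\sum_j c j *: x j) i = \sum_j c j *: co (x j) i.
Proof.
have /= -> := linear_sum (mk_linear (co_linear i)) (index_enum J) xpredT (fun j => c j *: x j).
by apply: eq_bigr => j _; rewrite -[c j *: x j]addr0 co_linear co0 addr0.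
Qed.

Let supported (Z : I -> Prop) (x : K) : Prop := forall i, ~ Z i -> co x i = 0.

Section Lifting.
Variables (X Y : lmodType A) (g : {linear X -> Y}) (f : {linear K -> Y}).
Hypothesis g_surj : surj g.

(* A set Z of type I + K * X encodes a subset J of I together with the graph of a
   lift of f, defined on the elements whose coordinates are supported in J. *)
Let lifting (Z : classical_sets.set (I + K * X)) : Prop :=
  [/\ forall x y, Z (inr (x, y)) -> g y = f x /\ supported (Z \o inl) x,
      forall y, Z (inr (0, y)) -> y = 0,
      forall a x x' y y', Z (inr (x, y)) -> Z (inr (x', y')) ->
        Z (inr (a *: x + x', a *: y + y'))
    & forall x, supported (Z \o inl) x -> exists y, Z (inr (x, y))].

Let lifting0 : lifting (fun t => t = inr (0, 0)).
Proof.
split=> [x y [-> ->]|y [] //|a x x' y y' [-> ->] [-> ->]|x sx].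
- by rewrite !linear0; split=> // i _; apply: co0.
- by rewrite !scaler0 !addr0.
- by exists 0; rewrite (co_inj (x := x)) // => i; apply: sx.
Qed.

Let lifting_chain (F : classical_sets.set (classical_sets.set (I + K * X))) :
    (forall Z, F Z -> (forall t, ~ Z t) \/ lifting Z) ->
    (forall Z Z', F Z -> F Z' -> (forall t, Z t -> Z' t) \/ (forall t, Z' t -> Z t)) ->
  let U t := exists2 Z, F Z & Z t in (forall t, ~ U t) \/ lifting U.
Proof.
move=> Flift Ftot U.
have [[Z0 FZ0 lZ0]|noZ] := pselect (exists2 Z, F Z & lifting Z); last first.
  left=> t [Z FZ Zt]; case: (Flift Z FZ) => [/(_ t)//|lZ].
  by apply: noZ; exists Z.
right.
have Fl Z t : F Z -> Z t -> lifting Z.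
  by move=> FZ Zt; case: (Flift Z FZ) => [/(_ t)//|].
split=> [x y [Z FZ Zxy]|y [Z FZ Zy]|a x x' y y' [Z FZ Zxy] [Z' FZ' Zxy']|x sx].
- have [/(_ _ _ Zxy)[gy sx] _ _ _] := Fl _ _ FZ Zxy; split=> // i nUi.
  by apply: sx => Zi; apply: nUi; exists Z.
- by have [_ /(_ _ Zy)] := Fl _ _ FZ Zy.
- have [ZZ'|Z'Z] := Ftot _ _ FZ FZ'.
    have [_ _ ZD _] := Fl _ _ FZ' Zxy'; exists Z' => //; apply: ZD => //; exact: ZZ'.
  have [_ _ ZD _] := Fl _ _ FZ Zxy; exists Z => //; apply: ZD => //; exact: Z'Z.
- have [s sP] := co_finite x.
  (* By totality of the chain, one member absorbs the support indices one at a time. *)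
  have [Z [FZ lZ sZ]] : exists Z, [/\ F Z, lifting Z
      & forall i, i \in s -> (U \o inl) i -> Z (inl i)].
    elim: s {sP} => [|i s [Z [FZ lZ sZ]]]; first by exists Z0.
    have [[Z' FZ' Zi]|nUi] := pselect ((U \o inl) i); last first.
      by exists Z; split=> // j; rewrite inE => /predU1P[->|/sZ].
    have [ZZ'|Z'Z] := Ftot _ _ FZ FZ'.
      exists Z'; split=> //; first exact: Fl FZ' Zi.
      move=> j; rewrite inE => /predU1P[->//|js Uj]; apply: ZZ'; exact: sZ.
    by exists Z; split=> // j; rewrite inE => /predU1P[-> _|/sZ//]; apply: Z'Z.
  have [_ _ _ /(_ x)[|y Zxy]] := lZ; last by exists y; exists Z.
  move=> i nZi; have [si|/sP//] := boolP (i \in s).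
  by apply: sx => Ui; apply/nZi/sZ.
Qed.

(** The [j]-th coordinates of elements supported in [J'] form a left ideal, whose dual basis splits
    off a complement of the part supported in [J]. On that complement the lift is built from
    preimages of finitely many values. *)
Let lifting_extend (Z : classical_sets.set (I + K * X)) (j : I) :
    lifting Z -> ~ Z (inl j) ->
  exists Z', [/\ lifting Z', forall t, Z t -> Z' t & Z' (inl j)].
Proof.
move=> [ZfJ Z0 ZD ZE] nZj.
pose J' i := Z (inl i) \/ i = j.
have sJ'D a x y : supported J' x -> supported J' y -> supported J' (a *: x + y).
  by move=> sx sy i ni; rewrite (co_linear i) sx // sy // scaler0 addr0.
pose L : {pred A^o} := fun a => `[< exists2 x, supported J' x & co x j = a >].
have L_closed : submod_closed L.
  split; first by apply/asboolP; exists 0 => // i _; apply: co0.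
  move=> a u v /asboolP[x sx <-] /asboolP[y sy <-]; apply/asboolP.
  by exists (a *: x + y); [apply: sJ'D | rewrite co_linear].
have [N [s [b [s_lin bL bE]]]] := hA L_closed.
have /choice[c cP] k : exists x, supported J' x /\ co x j = b k.
  by have /asboolP[x] := bL k; exists x.
have /choice[d dP] k : exists y, g y = f (c k) by apply: g_surj.
(* For [x] supported in [J'], [p x] has the same [j]-th coordinate as [x], so [x - p x] is supported
   in [J]; [q x] lifts [f (p x)]. *)
pose p x := \sum_k s k (co x j) *: c k.
pose q x := \sum_k s k (co x j) *: d k.
have inL x : supported J' x -> co x j \in L by move=> sx; apply/asboolP; exists x.
have pq_lin (V : lmodType A) (e : N -> V) a x y :
    supported J' x -> supported J' y ->
    \sum_k s k (co (a *: x + y) j) *: e k =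
    a *: (\sum_k s k (co x j) *: e k) + \sum_k s k (co y j) *: e k.
  move=> sx sy; rewrite scaler_sumr -big_split; apply: eq_bigr => k _ /=.
  by rewrite co_linear s_lin ?inL// scalerDl scalerA.
have gq x : g (q x) = f (p x).
  by rewrite !linear_sum; apply: eq_bigr => k _; rewrite !linearZ /= dP.
have sp x : supported J' (p x).
  move=> i ni; rewrite co_sum big1 // => k _.
  by have [sc _] := cP k; rewrite sc // scaler0.
have sxp x : supported J' x -> supported (Z \o inl) (x - p x).
  move=> sx i nZi; rewrite coB; have [->|/eqP ij] := eqVneq i j.
    rewrite co_sum [X in X - _](bE _ (inL _ sx)); apply/eqP; rewrite subr_eq0.
    by apply/eqP/eq_bigr => k _; have [_ ->] := cP k.
  by rewrite sx ?sp ?subrr // => -[].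
(* Both corrections vanish on elements supported in [J]; hence the new graph contains the old
   one. *)
have p0 x : supported (Z \o inl) x -> p x = 0 /\ q x = 0.
  move=> sx; have L0 : 0 \in L by apply: L_closed.1.
  have xj : co x j = 0 by apply: sx.
  by split; apply: big1 => k _; rewrite xj (linear_on0 L0 (s_lin k)) scale0r.
(* The new lift sends [x] to the old value at [x - p x] plus [q x]. *)
pose Z' t := match t with
  | inl i => J' i
  | inr (x, y) => supported J' x /\ Z (inr (x - p x, y - q x))
  end.
have sZJ x : supported (Z \o inl) x -> supported J' x.
  by move=> sx i ni; apply: sx => Zi; apply: ni; left.
exists Z'; split=> [|[i|[x y]] /= Zt|]; [|by left| |by right].
- split=> [x y [sx Zxy]|y [s0 Zy]|a x x' y y' [sx Zxy] [sx' Zxy']|x sx].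
  + have [gy _] := ZfJ _ _ Zxy; split=> //.
    by move: gy; rewrite !linearB gq => /addIr.
  + have [|p00 q00] := p0 0; first by move=> i _; apply: co0.
    by move: Zy; rewrite p00 q00 !subr0; apply: Z0.
  + split; first exact: sJ'D.
    have -> : p (a *: x + x') = a *: p x + p x' by apply: pq_lin.
    have -> : q (a *: x + x') = a *: q x + q x' by apply: pq_lin.
    have DB (V : lmodType A) (u u' v v' : V) :
        a *: u + u' - (a *: v + v') = a *: (u - v) + (u' - v').
      by rewrite opprD addrACA -scalerBr.
    by rewrite !DB; apply: ZD.
  + have [y Zy] := ZE _ (sxp _ sx).
    by exists (y + q x); split=> //; rewrite addrK.
- have [_ sx] := ZfJ _ _ Zt; have [p0x q0x] := p0 _ sx.
  by rewrite /= p0x q0x !subr0; split=> //; apply: sZJ.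
Qed.

(** A maximal lifting has every index in [J], otherwise [lifting_extend] enlarges it; its graph is
    then total. *)
Lemma lift_of_coordinates : exists h : {linear K -> X}, forall x, g (h x) = f x.
Proof.
have [|Z [PZ Zmax]] := @classical_sets.Zorn_bigcup (I + K * X)
    (fun Z => (forall t, ~ Z t) \/ lifting Z).
  move=> F FP Ftot; apply: lifting_chain; first exact: FP.
  by move=> Z Z' FZ FZ'; apply: Ftot.
(* The empty set is not maximal, since the zero lifting strictly contains it. *)
have lZ : lifting Z.
  case: PZ => // Z0; case: (Zmax (fun t => t = inr (0, 0))); last by right.
  split=> [t /Z0//|/(_ (inr (0, 0)) erefl)]; exact: Z0.
have ZJ i : Z (inl i).
  apply: contrapT => nZi; have [Z' [lZ' ZZ' Z'i]] := lifting_extend lZ nZi.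
  by case: (Zmax Z'); [split=> // Z'Z; apply/nZi/Z'Z|right].
have [Zf Z0 ZD ZE] := lZ.
have [|h hP] := @linear_of_graph _ _ _ (fun x y => Z (inr (x, y))) _ Z0 ZD.
  by move=> x; apply: ZE => i [].
by exists h => x; have [] := Zf _ _ (hP x).
Qed.

End Lifting.

Lemma projective_of_coordinates : projective K.
Proof. by move=> X Y g f; apply: lift_of_coordinates. Qed.

End Kaplansky.
End Hereditary.

(** * Kernels as modules *)

Section KernelModule.
Variables (A : pzRingType) (U V : lmodType A) (f : {linear U -> V}).

Definition kernel_pred : {pred U} := fun x => f x == 0.

Fact kernel_closed : submod_closed kernel_pred.
Proof.
split=> [|a x y]; first by rewrite unfold_in linear0.
by rewrite !unfold_in linearP => /eqP-> /eqP->; rewrite scaler0 addr0.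
Qed.

Definition kernel : lmodType A := submodule kernel_closed.

Definition kernel_val : {linear kernel -> U} :=
  (\val : {linear submodule kernel_closed -> U}).

Lemma kernel_val_inj : injective kernel_val.
Proof. exact: val_inj. Qed.

Lemma kernel_valP x : f x = 0 <-> exists y, kernel_val y = x.
Proof.
split=> [fx|[y <-]]; last by case: y => y /= /eqP.
have kx : x \in kernel_pred by apply/eqP.
by exists (Submodule kernel_closed kx).
Qed.

End KernelModule.

(** * Free modules on arbitrary sets *)

Section FreeModule.
Variables (A : pzRingType) (I : choiceType).

Definition finsupp_pred : {pred I -> A^o} :=
  fun c => `[< exists s : seq I, forall i, i \notin s -> c i = 0 >].

Fact finsupp_closed : submod_closed finsupp_pred.
Proof.
split=> [|a c d /asboolP[s sP] /asboolP[t tP]]; apply/asboolP; first by exists [::].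
exists (s ++ t) => i; rewrite mem_cat negb_or => /andP[/sP ci /tP di].
by rewrite -[LHS]/(a * c i + d i) ci di mulr0 addr0.
Qed.

Definition free_module : lmodType A := submodule finsupp_closed.

Definition coordinate (c : free_module) : I -> A := submodule_val c.
Arguments coordinate : simpl never.

Lemma coordinateP a c d i :
  coordinate (a *: c + d) i = a * coordinate c i + coordinate d i.
Proof. by []. Qed.

Lemma free_module_ext c d : coordinate c =1 coordinate d -> c = d.
Proof. by move=> cd; apply/val_inj/funext. Qed.

Lemma coordinate_finite c : exists s : seq I, forall i, i \notin s -> coordinate c i = 0.
Proof. by case: c => c sc; apply/asboolP. Qed.

Variables (M : lmodType A) (m : I -> M).

Definition free_supp (c : free_module) : seq I := undup (sval (cid (coordinate_finite c))).

Definition free_sum (c : free_module) : M := \sum_(i <- free_supp c) coordinate c i *: m i.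

(** Zero coordinates contribute nothing, so any two duplicate-free lists give sums over the same
    nonzero indices, up to order. *)
Lemma free_sumE c (s : seq I) : uniq s -> (forall i, i \notin s -> coordinate c i = 0) ->
  free_sum c = \sum_(i <- s) coordinate c i *: m i.
Proof.
have E t : \sum_(i <- t) coordinate c i *: m i =
    \sum_(i <- [seq i <- t | coordinate c i != 0]) coordinate c i *: m i.
  rewrite big_filter [RHS]big_mkcond; apply: eq_bigr => i _.
  by case: eqP => // ->; rewrite scale0r.
move=> s_uniq sP; rewrite /free_sum E [RHS]E; apply/perm_big/uniq_perm.
- by rewrite filter_uniq // undup_uniq.
- by rewrite filter_uniq.
move=> i; rewrite !mem_filter; case: eqP => //= ci.
have in_s t : (forall i, i \notin t -> coordinate c i = 0) -> i \in t.
  by move=> tP; apply/negPn/negP => /tP.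
by rewrite mem_undup !in_s //; case: cid.
Qed.

Fact free_sum_linear : linear free_sum.
Proof.
move=> a c d; have [[s sP] [t tP]] := (coordinate_finite c, coordinate_finite d).
have in_st r i : i \notin undup (s ++ t) -> r = s \/ r = t -> i \notin r.
  by rewrite mem_undup mem_cat negb_or => /andP[? ?] [] ->.
rewrite !(@free_sumE _ (undup (s ++ t))) ?undup_uniq //.
- rewrite scaler_sumr -big_split; apply: eq_bigr => i _ /=.
  by rewrite coordinateP scalerDl scalerA.
all: move=> i nst.
- exact/tP/(in_st _ _ nst)/or_intror.
- exact/sP/(in_st _ _ nst)/or_introl.
rewrite coordinateP sP ?tP ?mulr0 ?addr0 //; apply: in_st nst _; tauto.
Qed.

Definition free_map : {linear free_module -> M} := mk_linear free_sum_linear.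

Fact basis_subproof i : (fun j => (i == j)%:R : A^o) \in finsupp_pred.
Proof. by apply/asboolP; exists [:: i] => j; rewrite inE eq_sym => /negPf->. Qed.

Definition free_basis i : free_module := Submodule finsupp_closed (basis_subproof i).

Lemma free_map_basis i : free_map (free_basis i) = m i.
Proof.
rewrite /free_map mk_linearE (@free_sumE _ [:: i]) //.
  by rewrite big_seq1 /coordinate /= eqxx scale1r.
by move=> j; rewrite inE eq_sym /coordinate /= => /negPf->.
Qed.

End FreeModule.

Lemma projective_trivial (A : pzRingType) (P : lmodType A) :
  (forall x : P, x = 0) -> projective P.
Proof. by move=> P0 X Y g f _; exists \0 => x; rewrite (P0 x) !linear0. Qed.

(** * Global dimension of hereditary rings *)

Section HereditaryGlobalDimension.
Variables (A : pzRingType) (hA : hereditary A).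

Lemma projective_free_module (I : choiceType) : projective (free_module A I).
Proof.
apply: (projective_of_coordinates hA (co := @coordinate A I)).
- by move=> i a x y; rewrite [LHS]coordinateP.
- by move=> x x0; apply: free_module_ext => i; rewrite x0.
- exact: coordinate_finite.
Qed.

Lemma projective_kernel (I : choiceType) (M : lmodType A) (f : {linear free_module A I -> M}) :
  projective (kernel f).
Proof.
apply: (@projective_of_coordinates A hA (kernel f) I (fun x => coordinate (kernel_val f x))).
- by move=> i a x y; rewrite linearP [LHS]coordinateP.
- by move=> x x0; apply/kernel_val_inj/free_module_ext => i; rewrite x0 linear0.
- by move=> x; have [s sP] := coordinate_finite (kernel_val f x); exists s.
Qed.

(** The kernel of a free cover embeds in a free module, hence is projective; the resolution stops
    there. *)
Lemma hereditary_gldim_le1 : gldim_le A 1.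
Proof.
move=> M.
(* Every element of [M] serves as a generator; all terms from degree 2 on are the zero module
   [Z]. *)
pose F := free_module A M; pose e : {linear F -> M} := free_map id.
pose Z : lmodType A := 'rV[A]_0.
have Z0 (x : Z) : x = 0 by apply/rowP => -[].
pose P i : lmodType A := match i with 0%N => F | 1%N => kernel e | _ => Z end.
pose d i : {linear P i.+1 -> P i} :=
  match i with 0%N => kernel_val e | _ => \0 end.
exists P, d, e; split.
- move=> [|[|i]]; last exact: projective_trivial.
    exact: projective_free_module.
  exact: projective_kernel.
- by move=> [|[|i]].
- by move=> x; exists (free_basis A x); apply: free_map_basis.
- exact: kernel_valP.
- move=> [|i] x; split=> [dx|[y <-]]; rewrite /= ?linear0 //; exists 0.
  by apply/kernel_val_inj; rewrite linear0; apply: esym dx.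
Qed.

End HereditaryGlobalDimension.

(* Schanuel's argument, comparing a resolution of A/L with the surjection A -> A/L. *)
Lemma gldim_le1_dual_basis (A : pzRingType) (n : nat) (g : 'I_n -> A^o) (L : {pred A^o}) :
  gldim_le A 1 -> submod_closed L -> (forall i, g i \in L) ->
  (forall x, x \in L -> exists c : 'I_n -> A, x = \sum_i c i *: g i) ->
  exists s : 'I_n -> A^o -> A^o, (forall i, linear_on L (s i)) /\
    {in L, forall x, x = \sum_i s i x *: g i}.
Proof.
move=> hA L_closed gL Lgen.
have [P [d [e [Pproj Pn e_surj e_exact d_exact]]]] := hA (quotient_module L_closed).
pose q : {linear A^o -> quotient_module L_closed} := quotient_map L_closed.
have q_surj : surj q by apply: quotient_mapP.
(* Comparison maps over A/L in both directions: [u] from [P 0] to A by projectivity, [v] from A to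
   [P 0] by choosing the image of 1. *)
have [u uP] := Pproj 0%N _ _ q e q_surj.
have [v0 v0P] : exists y, e y = q 1 by apply: e_surj.
pose v x : P 0%N := x *: v0.
have vP x : e (v x) = q x by rewrite linearZ /= v0P -linearZ /= /GRing.scale /= mulr1.
have d_inj x : d 0%N x = 0 -> x = 0.
  by move=> /d_exact[y <-]; rewrite (Pn 2%N _ y) ?linear0.
have qL x : x \in L -> q x = 0 by move=> xL; apply/quotient_map_eq0.
(* For [x] in [L], [v x] dies in A/L, so it comes from a unique [w x] in [P 1]; the value off [L] is
   a dummy. *)
have wP x : exists w, x \in L -> d 0%N w = v x.
  have [xL|_] := boolP (x \in L); last by exists 0.
  by have /e_exact[w wx] : e (v x) = 0 by [rewrite vP qL]; exists w.
have /choice[w {}wP] := wP.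
have w_lin a : {in L &, forall x y, w (a *: x + y) = a *: w x + w y}.
  move=> x y xL yL; apply/eqP; rewrite -subr_eq0; apply/eqP/d_inj.
  rewrite linearB linearP /= !wP //; last exact: L_closed.2.
  by rewrite /v scalerDl scalerA subrr.
have /choice[c cP] x : exists c : 'I_n -> A, x \in L -> x = \sum_i c i *: g i.
  by have [/Lgen[c ->]|_] := boolP (x \in L); [exists c | exists (fun=> 0)].
have uvL : 1 - u v0 \in L.
  apply/(quotient_map_eq0 L_closed).
  have := linearB q 1 (u v0); rewrite uP v0P subrr; exact.
pose E : lmodType A := submodule L_closed.
pose G0 (c : {ffun 'I_n -> A^o}) : A^o := \sum_i c i *: g i.
have G0L c0 : G0 c0 \in L.
  have L0 : 0 \in L by apply: L_closed.1.
  apply: (big_ind (fun x => x \in L)) => // [x y xL yL|i _].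
    by rewrite -[x]scale1r; apply: L_closed.2.
  by rewrite -[_ *: _]addr0; apply: L_closed.2.
have G_lin : linear (fun c => Submodule L_closed (G0L c) : E).
  move=> a x y; apply/val_inj => /=; rewrite /G0 scaler_sumr -big_split.
  by apply: eq_bigr => i _; rewrite /= !ffunE scalerDl scalerA.
pose G := mk_linear G_lin.
have G_surj : surj G.
  move=> [x xL]; exists [ffun i => c x i]; apply/val_inj => /=.
  by rewrite [RHS](cP x xL); apply: eq_bigr => i _; rewrite ffunE.
(* [e] kills the image of [d 0], so [u] maps that image into [L]; projectivity of [P 1] lifts the
   result through [G]. *)
have udL y : u (d 0%N y) \in L.
  apply/(quotient_map_eq0 L_closed); rewrite [LHS]uP.
  by apply/e_exact; exists y.
have ud_lin : linear (fun y => Submodule L_closed (udL y) : E).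
  by move=> a x y; apply/val_inj; rewrite /= !linearP.
have [h hP] := Pproj 1%N _ _ G (mk_linear ud_lin) G_surj.
(* From x = x (1 - u v0) + u (v x): the first summand uses fixed coefficients of [1 - u v0], the
   second is u (d (w x)) = G (h (w x)). *)
exists (fun i x => x * c (1 - u v0) i + h (w x) i); split.
  move=> i a x y xL yL; rewrite w_lin // linearP !ffunE mulrDl scalerDr [RHS]addrACA.
  by congr (_ + _ + _); apply/esym/mulrA.
move=> x xL; have := congr1 \val (hP (w x)) => /= hwx.
transitivity (x *: (1 - u v0) + u (v x)).
  by rewrite linearZ /= -scalerDr subrK /GRing.scale /= mulr1.
rewrite -wP // -hwx {1}(cP _ uvL) scaler_sumr -big_split; apply: eq_bigr => i _.
by rewrite /= scalerDl scalerA.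
Qed.

(** With [P 1] zero, [e] is an isomorphism from the projective module [P 0] onto [Q]. *)
Lemma gldim_le0_projective (A : pzRingType) (Q : lmodType A) : gldim_le A 0 -> projective Q.
Proof.
move=> /(_ Q)[P [d [e [Pproj Pn e_surj e_exact _]]]] X Y g f g_surj.
have e_inj x : e x = 0 -> x = 0.
  by move=> /e_exact[y <-]; rewrite (Pn 1%N _ y) ?linear0.
have [h hP] := Pproj 0%N X Y g (f \o e) g_surj.
have [e' e'P] := choice e_surj.
have e'_lin : linear e'.
  move=> a x y; apply/eqP; rewrite -subr_eq0; apply/eqP/e_inj.
  by rewrite linearB linearP /= !e'P subrr.
by exists (h \o mk_linear e'_lin) => x; rewrite /= hP /= e'P.
Qed.

(** * Endomorphism rings of generators *)

Lemma generated_by_in (R : comNzRingType) (I : {pred R}) (n : nat) (g : 'I_n -> R) i :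
  generated_by I g -> g i \in I.
Proof.
move=> gI; apply/gI; exists (fun j => (j == i)%:R).
by rewrite (bigD1 i) //= eqxx mul1r big1 ?addr0 // => j /negPf->; rewrite mul0r.
Qed.

Section GeneratorOfGlobalDimensionOne.
Variables (R : comNzRingType) (M : lmodType R).

(** The element (1, 0) of [R^o * N'] becomes a vector of M^n; applying the inverse isomorphism
    component by component and projecting to R recovers 1. *)
Lemma generator_trace : generator M ->
  exists (n : nat) (m : 'I_n -> M) (b : 'I_n -> {linear M -> R^o}),
    \sum_i b i (m i) = 1.
Proof.
move=> [n [N' [f [f' fK f'K]]]].
have f'_lin : linear f'.
  by move=> a x y; rewrite -{1}[x]f'K -{1}[y]f'K -linearP fK.
pose e (i : 'I_n) (x : M) : {ffun 'I_n -> M} := [ffun k => if k == i then x else 0].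
pose b0 (i : 'I_n) (x : M) : R^o := (f' (e i x)).1.
have b_lin i : linear (b0 i).
  move=> a x y; transitivity (a *: f' (e i x) + f' (e i y)).1 => //; rewrite -f'_lin.
  congr (f' _).1; apply/ffunP => k; rewrite !ffunE.
  by case: eqP => _ //; rewrite scaler0 addr0.
exists n, (f (1, 0)), (fun i => mk_linear (b_lin i)).
transitivity ((f' (\sum_i e i (f (1, 0) i))).1).
  have /= -> := linear_sum (mk_linear f'_lin) (index_enum 'I_n) xpredT
    (fun i => e i (f (1, 0) i)).
  by rewrite (big_morph (@fst R^o N') (id1 := 0) (op1 := +%R)).
have -> : \sum_i e i (f (1, 0) i) = f (1, 0).
  apply/ffunP => k; rewrite sum_ffunE (bigD1 k) //= ffunE eqxx big1 ?addr0 // => i.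
  by rewrite ffunE eq_sym => /negPf->.
by rewrite fK.
Qed.

Fact homothety_linear (a : R) : linear (fun x : M => a *: x).
Proof. by move=> c x y; rewrite scalerDr !scalerA mulrC. Qed.

(** Typed in the regular module of the opposite ring, whose left ideals are the right ideals of
    End(M). *)
Definition homothety (a : R) : ((endo M)^c)^o := mk_linear (homothety_linear a).

Let ev (l : ((endo M)^c)^o) (x : M) : M := (l : endo M) x.

Let ev_sum (I : finType) (F : I -> ((endo M)^c)^o) x :
  ev (\sum_i F i) x = \sum_i ev (F i) x.
Proof. by apply: (big_morph (ev^~ x)). Qed.

(* The dual basis of the one-sided ideal I . End(M) restricts to one of I by
   means of the trace of the generator. *)
Lemma generator_hereditary :
  noetherian R -> generator M -> gldim_le (endo M)^c 1 -> hereditary R.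
Proof.
move=> noethR /generator_trace[r [m [b bm]]] gl I I_closed.
have [n [g gI]] := noethR I I_closed.
(* The right ideal I End(M). *)
pose L : {pred ((endo M)^c)^o} :=
  fun l => `[< exists c : 'I_n -> (endo M)^c, l = \sum_i c i *: homothety (g i) >].
have L_closed : submod_closed L.
  split=> [|a x y /asboolP[c ->] /asboolP[d ->]]; apply/asboolP.
    by exists (fun=> 0); rewrite big1 // => i _; rewrite scale0r.
  exists (fun i => a * c i + d i); rewrite scaler_sumr -big_split.
  by apply: eq_bigr => i _; rewrite /= scalerDl scalerA.
have gL i : homothety (g i) \in L.
  apply/asboolP; exists (fun j => (j == i)%:R); rewrite (bigD1 i) //= eqxx scale1r.
  by rewrite big1 ?addr0 // => j /negPf->; rewrite scale0r.
have hL x : x \in I -> homothety x \in L.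
  move=> /gI[c ->]; apply/asboolP; exists (fun i => homothety (c i)).
  apply: endoP => y; apply/esym; apply: (etrans (ev_sum _ y)).
  rewrite [RHS]scaler_suml; apply: eq_bigr => i _.
  by rewrite mulrC -scalerA.
have [|s [s_lin sE]] := gldim_le1_dual_basis gl L_closed gL.
  by move=> x /asboolP.
(* The endomorphism [s i (homothety x)] is evaluated at each [m j], sent to R by [b j], and summed
   over [j]. *)
exists 'I_n, (fun i x => \sum_j b j (ev (s i (homothety x)) (m j))), g; split.
- move=> i a x y xI yI; rewrite scaler_sumr -big_split; apply: eq_bigr => j _ /=.
  have -> : homothety (a *: x + y) = (homothety a : (endo M)^c) *: homothety x + homothety y.
    by apply: endoP => z /=; rewrite scalerDl -scalerA /= !scalerA mulrC.
  (* In the opposite ring [homothety a] acts by precomposition, so it scales the argument [m j]. *)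
  rewrite s_lin ?hL // -[ev _ _]/(ev (s i (homothety x)) (a *: m j) + ev _ _).
  by rewrite /ev linearZ linearP.
- by move=> i; apply: generated_by_in gI.
- move=> x xI; rewrite -[x in LHS]mulr1 -bm mulr_sumr.
  under [RHS]eq_bigr do rewrite scaler_suml.
  rewrite exchange_big; apply: eq_bigr => j _ /=.
  transitivity (b j (ev (homothety x) (m j))); first by rewrite [RHS]linearZ.
  rewrite {1}(sE _ (hL x xI)) ev_sum linear_sum; apply: eq_bigr => i _.
  by rewrite [LHS]linearZ [LHS]mulrC.
Qed.

End GeneratorOfGlobalDimensionOne.

(** * Localization *)

Section Ideals.
Variable R : comNzRingType.

Definition mk_ideal (I : {pred R}) (clI : idealr_closed I) : idealr R :=
  HB.pack (I : R -> bool) (isIdealr.Build R I clI).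

Definition mk_prime (I : {pred R}) (clI : idealr_closed I)
    (prI : prime_idealr_closed I) : prime_idealr R :=
  HB.pack (I : R -> bool) (isIdealr.Build R I clI) (isPrimeIdealrClosed.Build R I prI).

Lemma idealr_submod_closed (I : idealr R) : submod_closed (I : {pred R^o}).
Proof.
split=> [|a x y xI yI]; first exact: idealr0.
by rewrite rpredD // idealMr.
Qed.

End Ideals.

Section LocalizationTheory.
Variables (R : comNzRingType) (p : prime_idealr R).
Local Notation S := (locring p).
Implicit Types (a b : R) (s t : denom p).

Lemma rfracP (w : S) : exists a s, w = rfrac a s.
Proof. exact: (@fracP R p R^o w). Qed.

Lemma rfrac_eq0 a s : rfrac a s = 0 <-> exists u : denom p, den u * a = 0.
Proof.
split=> [/fracE[u]|[u ua]]; first by rewrite scale1r !scaler0; exists u.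
by apply/fracE; exists u; rewrite scale1r !scaler0.
Qed.

Lemma rfracM a s b t : rfrac a s * rfrac b t = rfrac (a * b) (denomM s t).
Proof. exact: loc_mulE. Qed.

Lemma rfrac_sum (I : finType) (F : I -> R) s :
  rfrac (\sum_i F i) s = \sum_i rfrac (F i) s.
Proof.
apply: (big_morph (fun a => rfrac a s)) => [a b|]; last first.
  by apply/rfrac_eq0; exists s; rewrite mulr0.
by rewrite rfracD; apply: rfrac_eq => /=; ring.
Qed.

Lemma rfrac_split a b s : rfrac (a * b) s = rfrac a s * rfrac b (denom1 p).
Proof. by rewrite rfracM; apply: rfrac_eq => /=; ring. Qed.

Lemma rfrac_den a s : rfrac a (denom1 p) = rfrac (den s) (denom1 p) * rfrac a s.
Proof. by rewrite rfracM; apply: rfrac_eq => /=; ring. Qed.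

Lemma rfrac0 : rfrac 0 (denom1 p) = 0.
Proof. by apply/rfrac_eq0; exists (denom1 p); rewrite mulr0. Qed.

Lemma rfracMD a b c : rfrac (a * b + c) (denom1 p) =
  rfrac a (denom1 p) * rfrac b (denom1 p) + rfrac c (denom1 p).
Proof. by rewrite rfracM rfracD; apply: rfrac_eq => /=; ring. Qed.

(** Denominators are units, so an ideal of R_p is generated by its contraction to R. *)
Lemma noetherian_locring : noetherian R -> noetherian S.
Proof.
move=> noethR I [I0 ID].
have IZ (c x : S) : x \in I -> c * x \in I.
  by move=> xI; rewrite -[_ * _]addr0; apply: ID.
pose J : {pred R^o} := fun a => rfrac a (denom1 p) \in I.
have [|n [g gJ]] := noethR J.
  split=> [|a b c bJ cJ]; first by rewrite unfold_in rfrac0.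
  rewrite -[_ \in _]/(rfrac (a * (b : R) + (c : R)) (denom1 p) \in I) rfracMD.
  exact: ID.
exists n, (fun i => rfrac (g i) (denom1 p)) => x; split=> [xI|[c ->]].
  have [a [s xE]] := rfracP x; have /gJ[c aE] : a \in J.
    by rewrite unfold_in (rfrac_den a s) -xE IZ.
  exists (fun i => rfrac (c i) s); rewrite xE aE rfrac_sum.
  by apply: eq_bigr => i _; apply: rfrac_split.
apply: (big_ind (fun x => x \in I)) => // [y z yI zI|i _].
  by rewrite -[y]mul1r; apply: ID.
exact/IZ/(generated_by_in i gJ).
Qed.

Definition loc_max_pred : {pred S} := fun w => `[< exists a s, a \in p /\ w = rfrac a s >].

(** Primality of [p] cancels the denominators, so membership does not depend on the fraction
    chosen. *)
Lemma rfrac_max a s : (rfrac a s \in loc_max_pred) = (a \in p).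
Proof.
apply/asboolP/idP => [[b [t [bp /fracE[u e]]]]|ap]; last by exists a, s.
have : den u * (den t * a) \in p by rewrite [X in X \in p]e !idealMr.
by rewrite !prime_idealrM !(negPf (denP _)).
Qed.

Fact loc_max_closed : idealr_closed loc_max_pred.
Proof.
split; first by apply/asboolP; exists 0, (denom1 p); split=> //; apply: idealr0.
  by rewrite rfrac_max idealr1.
move=> w x y; have [[a [s ->]] [b [t ->]]] := (rfracP w, rfracP x).
have [c [u ->]] := rfracP y.
rewrite rfracM rfracD !rfrac_max => bp cp.
by rewrite rpredD // !idealMr.
Qed.

Fact loc_max_prime : prime_idealr_closed loc_max_pred.
Proof.
move=> x y; have [[a [s ->]] [b [t ->]]] := (rfracP x, rfracP y).
by rewrite rfracM !rfrac_max prime_idealrM.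
Qed.

Definition loc_max : prime_idealr S := mk_prime loc_max_closed loc_max_prime.

Lemma loc_unit (w : S) : w \notin loc_max -> exists v, v * w = 1.
Proof.
have [a [s ->]] := rfracP w; rewrite [_ \in _]rfrac_max => ap.
exists (rfrac (den s) (Denom ap)); rewrite rfracM.
by apply: rfrac_eq => /=; ring.
Qed.

Lemma idealr_sub_loc_max (I : idealr S) : {subset I <= loc_max}.
Proof.
move=> w wI; apply/negPn/negP => /loc_unit[v vw].
by have := idealr1 I; rewrite -vw idealMr.
Qed.

Lemma unique_loc_max : unique_maximal_ideal loc_max.
Proof.
split=> [I _|I Imax w]; first exact: idealr_sub_loc_max.
apply/idP/idP; first exact: idealr_sub_loc_max.
by apply: Imax; apply: idealr_sub_loc_max.
Qed.

Section Contraction.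
Variable q : prime_idealr S.

Definition contract_pred : {pred R} := fun a => rfrac a (denom1 p) \in q.

Let in_contract a : (a \in contract_pred) = (rfrac a (denom1 p) \in q).
Proof. by []. Qed.

Fact contract_closed : idealr_closed contract_pred.
Proof.
split; rewrite ?in_contract.
- by rewrite rfrac0 idealr0.
- by rewrite [X in X \in q](_ : _ = 1) ?idealr1.
by move=> a b c; rewrite !in_contract rfracMD => bq cq; rewrite rpredD // idealMr.
Qed.

Fact contract_prime : prime_idealr_closed contract_pred.
Proof. by move=> a b; rewrite !in_contract (rfrac_split a b) prime_idealrM. Qed.

Definition contract : prime_idealr R := mk_prime contract_closed contract_prime.

Lemma contractE a s : (a \in contract) = (rfrac a s \in q).
Proof.
rewrite [LHS]in_contract; apply/idP/idP => [|aq].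
  have -> : rfrac a s = rfrac 1 s * rfrac a (denom1 p) by rewrite -rfrac_split mul1r.
  exact: idealMr.
by rewrite (rfrac_den a s) idealMr.
Qed.

End Contraction.

(** By [contractE] an ideal is recovered from its contraction, so strict inclusions survive. This
    bounds the dimension of R_p by that of R. *)
Lemma contract_chain k (q : nat -> prime_idealr S) :
  prime_chain k q -> prime_chain k (fun i => contract (q i)).
Proof.
move=> chq i /chq[qq nqq]; split=> [a|].
  rewrite (contractE _ a (denom1 p)) (contractE _ a (denom1 p)); exact: qq.
move=> sub; apply: nqq => w; have [a [s ->]] := rfracP w.
by rewrite -!contractE; apply: sub.
Qed.

End LocalizationTheory.

(** * Localizations of hereditary rings *)

Section HereditaryRegular.
Variables (R : comNzRingType) (hR : hereditary R) (p : prime_idealr R).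
Local Notation S := (locring p).

(** A dual basis of the ideal Rx produces [e] with e x = x and a e = 0, and one of [e], [1 - e] lies
    outside [p]. Thus R_p is a domain. *)
Lemma hereditary_zero_divisor (a x : R) : a * x = 0 ->
  (exists u : denom p, den u * a = 0) \/ (exists u : denom p, den u * x = 0).
Proof.
move=> ax.
pose I : {pred R^o} := fun y => `[< exists r, y = r * x >].
have I_closed : submod_closed I.
  split=> [|c y z /asboolP[r ->] /asboolP[r' ->]]; apply/asboolP.
    by exists 0; rewrite mul0r.
  by exists (c * r + r'); rewrite mulrDl -mulrA.
have xI : x \in I by apply/asboolP; exists 1; rewrite mul1r.
have [J [s [g [s_lin gI gE]]]] := hR I_closed.
have /choice[r rP] j : exists r, g j = r * x by apply/asboolP/gI.
pose e := \sum_j s j x * r j.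
have ex : x = e * x.
  by rewrite {1}(gE x xI) mulr_suml; apply: eq_bigr => j _; rewrite rP; apply: mulrA.
have ae : a * e = 0.
  rewrite mulr_sumr big1 // => j _; rewrite mulrA.
  have asx : s j (a * x) = a * s j x by apply: (linear_onZ a I_closed.1 (s_lin j)).
  by rewrite -asx ax (linear_on0 I_closed.1 (s_lin j)) mul0r.
have [ep|ep] := boolP (e \in p); last by left; exists (Denom ep); rewrite mulrC.
have ep' : 1 - e \notin p.
  apply/negP => /(rpredD ep); rewrite addrC subrK => p1.
  by have := idealr1 p; rewrite p1.
by right; exists (Denom ep'); rewrite mulrBl -ex mul1r subrr.
Qed.

Fact loc_zero_closed : idealr_closed (pred1 (0 : S)).
Proof.
split; rewrite ?inE ?oner_eq0 // => w x y; rewrite !inE => /eqP-> /eqP->.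
by rewrite mulr0 addr0.
Qed.

Fact loc_zero_prime : prime_idealr_closed (pred1 (0 : S)).
Proof.
move=> x y; have [[a [s ->]] [b [t ->]]] := (rfracP x, rfracP y).
rewrite rfracM !inE => /eqP/rfrac_eq0[u]; rewrite mulrA => /hereditary_zero_divisor.
case=> -[v e]; apply/orP; [left|right]; apply/eqP/rfrac_eq0; last by exists v.
by exists (denomM v u); rewrite /= -mulrA.
Qed.

(* Evaluating the dual basis on a nonzero x in p gives (sum_i s_i(g_i)) x = x; so
   s_i(g_i) is invertible in R_p for some i, and then g_i generates p R_p. *)
Lemma hereditary_loc_max_principal x : x \in p -> rfrac x (denom1 p) <> 0 ->
  exists2 g, g \in p & forall y, y \in p -> forall t : denom p, exists c : S,
    rfrac y t = c * rfrac g (denom1 p).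
Proof.
move=> xp x0; have clp := idealr_submod_closed p.
have [J [s [g [s_lin gp gE]]]] := hR clp.
have sZ j a y : y \in p -> s j (a * y) = a * s j y.
  by move=> yp; apply: (linear_onZ a clp.1 (s_lin j)).
(* Both sides equal s_j(y z). *)
have sC j y z : y \in p -> z \in p -> s j z * y = s j y * z.
  by move=> yp zp; rewrite mulrC -sZ // mulrC sZ // mulrC.
have : (\sum_j s j (g j) - 1) * x = 0.
  rewrite mulrBl mul1r {2}(gE x xp) mulr_suml; apply/eqP; rewrite subr_eq0; apply/eqP.
  by apply: eq_bigr => j _; rewrite sC ?gp.
case/hereditary_zero_divisor => -[u]; last by move=> ux; case: x0; apply/rfrac_eq0; exists u.
move=> ud; have : den u * (\sum_j s j (g j) - 1) \in p by rewrite ud idealr0.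
rewrite prime_idealrM (negPf (denP u)) /= => dp.
(* The sum minus 1 lies in [p], so the sum does not, and some summand is outside [p]. *)
have [j sgj] : exists j, s j (g j) \notin p.
  apply: contrapT => nj; have : \sum_j s j (g j) - (\sum_j s j (g j) - 1) \in p.
    rewrite rpredB // rpred_sum // => j _.
    by apply/negPn/negP => sgj; apply: nj; exists j.
  by rewrite opprB addrC subrK idealr1.
exists (g j) => [|y yp t]; first exact: gp.
exists (rfrac (s j y) (denomM t (Denom sgj))); rewrite rfracM; apply: rfrac_eq => /=.
by rewrite mulr1 -mulrA sC ?gp.
Qed.

(** If pR_p is zero, R_p is a field, of dimension 0. Otherwise pR_p is principal, and the chain from
    0 to pR_p together with contraction to R gives dimension exactly 1. *)
Lemma hereditary_regular_local : noetherian R -> krull_dim_eq R 1 -> regular_local S.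
Proof.
move=> noethR [_ dimR]; split; first exact: noetherian_locring.
have [p0|/existsNP[x /not_implyP[xp x0]]] :=
    pselect (forall x, x \in p -> rfrac x (denom1 p) = 0).
  have max0 w : w \in loc_max p -> w = 0.
    have [a [s ->]] := rfracP w; rewrite [_ \in _]rfrac_max => /p0/rfrac_eq0[u ua].
    by apply/rfrac_eq0; exists u.
  have g0 : 'I_0 -> S by case.
  exists (loc_max p), 0%N, g0; split; first exact: unique_loc_max.
    split; first by exists (fun=> loc_max p).
    case=> // k q /(_ 0%N isT)[_ []] w /idealr_sub_loc_max/max0->; exact: idealr0.
  move=> w; split=> [/max0->|[c ->]]; first by exists g0; rewrite big_ord0.
  by rewrite big_ord0 idealr0.
have [g gp gE] := hereditary_loc_max_principal xp x0.
exists (loc_max p), 1%N, (fun=> rfrac g (denom1 p)); split; first exact: unique_loc_max.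
  split; last by move=> k q /contract_chain/dimR.
  exists (fun i => if i is 0%N then mk_prime loc_zero_closed loc_zero_prime else loc_max p).
  case=> // _; split=> [w /eqP->|sub]; first exact: idealr0.
  have /sub/eqP// : rfrac x (denom1 p) \in loc_max p by rewrite [_ \in _]rfrac_max.
move=> w; split=> [|[c ->]]; last by rewrite big_ord1 idealMr // [_ \in _]rfrac_max.
have [a [s ->]] := rfracP w; rewrite [_ \in _]rfrac_max => /gE/(_ s)[c ->].
by exists (fun=> c); rewrite big_ord1.
Qed.

End HereditaryRegular.

(** * Regular rings of dimension one *)

Section PrimeExistence.
Variables (R : comNzRingType) (T : idealr R).

Let ideal_set (X : classical_sets.set R) : Prop :=
  [/\ ~ X 1, forall x, x \in T -> X x & forall a x y, X x -> X y -> X (a * x + y)].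

Lemma exists_prime_over : exists p : prime_idealr R, {subset T <= p}.
Proof.
have [|X [PX Xmax]] := @classical_sets.Zorn_bigcup R
    (fun X => (forall x, ~ X x) \/ ideal_set X).
  move=> F FP Ftot.
  have [[Z0 FZ0 [Z01 TZ0 _]]|noZ] := pselect (exists2 Z, F Z & ideal_set Z); last first.
    left=> x [Z FZ Zx]; case: (FP Z FZ) => [/(_ x)//|iZ].
    by apply: noZ; exists Z.
  right.
  have Fi Z x : F Z -> Z x -> ideal_set Z.
    by move=> FZ Zx; case: (FP Z FZ) => [/(_ x)//|].
  split=> [[Z FZ Z1]|x xT|a x y [Z FZ Zx] [Z' FZ' Z'y]].
  - by have [] := Fi Z 1 FZ Z1.
  - by exists Z0 => //; apply: TZ0.
  - have [ZZ'|Z'Z] := Ftot _ _ FZ FZ'.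
      have [_ _ ZD] := Fi _ _ FZ' Z'y; exists Z' => //; apply: ZD => //; exact: ZZ'.
    have [_ _ ZD] := Fi _ _ FZ Zx; exists Z => //; apply: ZD => //; exact: Z'Z.
have [X1 TX XD] : ideal_set X.
  case: PX => // X0; case: (Xmax (fun x => x \in T)).
    by split=> [x /X0//|/(_ 0)]; rewrite idealr0 => /(_ isT)/X0.
  right; split=> [|//|a x y xT yT]; first by rewrite idealr1.
  by rewrite rpredD // idealMr.
have X0 : X 0 by apply/TX/idealr0.
pose P : {pred R} := fun x => `[< X x >].
have clP : idealr_closed P.
  split; [exact/asboolP | exact/asboolPn | ].
  by move=> a x y /asboolP Xx /asboolP Xy; apply/asboolP/XD.
have XM a x : X x -> X (a * x) by move=> Xx; rewrite -[_ * _]addr0; apply: XD.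
have span u : ~ X u -> exists a x, X x /\ a * u + x = 1.
  move=> Xu; apply: contrapT => nX.
  pose Y y := exists a x, X x /\ a * u + x = y.
  case: (Xmax Y); last first.
    right; split=> [//|x xT|a y z [b [x [Xx <-]]] [c [x' [Xx' <-]]]].
      by exists 0, x; rewrite mul0r add0r; split=> //; apply: TX.
    by exists (a * b + c), (a * x + x'); split; [apply: XD | ring].
  split=> [x Xx|YX]; first by exists 0, x; rewrite mul0r add0r.
  by apply/Xu/YX; exists 1, 0; rewrite mul1r addr0.
have prP : prime_idealr_closed P.
  move=> u v /asboolP Xuv; apply/orP; have [|Xu] := pselect (X u).
    by left; apply/asboolP.
  have [|Xv] := pselect (X v); first by right; apply/asboolP.
  have [[a [x [Xx e]]] [b [y [Xy e']]]] := (span u Xu, span v Xv).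
  (* Product of a u + x = 1 and b v + y = 1; every term of the expansion lies in [X]. *)
  case: X1; have -> : 1 = a * b * (u * v) + ((a * u) * y + (b * v + y) * x).
    by transitivity ((a * u + x) * (b * v + y)); [rewrite e e' mulr1 | ring].
  by apply: (XD _ _ _ Xuv); apply: (XD _ _ _ Xy); apply: XM.
by exists (mk_prime clP prP) => x /TX Xx; apply/asboolP.
Qed.

End PrimeExistence.

(** * Local rings with principal maximal ideal *)

Section PrincipalMaximalIdeal.
Variables (R : comNzRingType) (p : prime_idealr R).
Local Notation S := (locring p).
Variable pi : S.
Hypothesis piP : forall w, w \in loc_max p <-> exists c, w = c * pi.

(* Krull's intersection theorem for a principal maximal ideal. *)
Lemma unit_pi_power (w : S) : noetherian S -> w <> 0 ->
  exists (k : nat) (v : S), v \notin loc_max p /\ w = v * pi ^+ k.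
Proof.
move=> noethS w0; apply: contrapT => nw.
pose Q (y : S) := y <> 0 /\
  ~ exists (k : nat) (v : S), v \notin loc_max p /\ y = v * pi ^+ k.
(* A nonzero element that is not a unit times a power of [pi] is divisible by [pi], with a quotient
   of the same kind; elements failing [Q] get the dummy value 0. *)
have /choice[next nextP] y : exists y', Q y -> y = pi * y' /\ Q y'.
  have [Qy|nQ] := pselect (Q y); last by exists 0.
  have [y0 ny] := Qy; have /piP[c yE] : y \in loc_max p.
    apply/negPn/negP => ym; apply: ny; exists 0%N, y; split=> //.
    by rewrite expr0 mulr1.
  exists c; split; first by rewrite mulrC.
  split=> [c0|[k [v [vm cE]]]]; first by apply: y0; rewrite yE c0 mul0r.
  by apply: ny; exists k.+1, v; split=> //; rewrite yE cE exprSr mulrA.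
pose y i := iter i next w.
have Qy i : Q (y i) by elim: i => [//|i /nextP[]].
have yS i : y i = pi * y i.+1 by have [] := nextP _ (Qy i).
have y_le i j : (i <= j)%N -> exists c, y i = c * y j.
  elim: j => [|j IH]; first by rewrite leqn0 => /eqP->; exists 1; rewrite mul1r.
  rewrite leq_eqVlt => /predU1P[->|/IH[c ->]]; first by exists 1; rewrite mul1r.
  by rewrite yS; exists (c * pi); rewrite mulrA.
(* Union of the increasing chain of ideals generated by the [y k]; noetherianity makes it stop at
   some [K]. *)
pose N : {pred S^o} := fun z => `[< exists k c, z = c * y k >].
have clN : submod_closed N.
  split=> [|a u v /asboolP[k [c ->]] /asboolP[l [d ->]]]; apply/asboolP.
    by exists 0%N, 0; rewrite mul0r.
  have [c' cE] := y_le _ _ (leq_maxl k l); have [d' dE] := y_le _ _ (leq_maxr k l).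
  exists (maxn k l), (a * c * c' + d * d').
  by rewrite cE dE /GRing.scale /=; ring.
have [n [g gN]] := noethS N clN.
have /choice[k kP] i : exists k, exists c, g i = c * y k.
  exact/asboolP/(generated_by_in i gN).
pose K := \max_i k i.
have /choice[c cP] i : exists c, g i = c * y K.
  have [c ->] := kP i; have [d ->] := y_le _ _ (leq_bigmax i : (k i <= K)%N).
  by exists (c * d); rewrite mulrA.
have /gN[d yE] : y K.+1 \in N by apply/asboolP; exists K.+1, 1; rewrite mul1r.
(* [y K.+1] is a multiple of [y K], which is [pi * y K.+1]; hence [1 - e], a unit, kills
   [y K.+1]. *)
pose e := (\sum_i d i * c i) * pi.
have ye : (1 - e) * y K.+1 = 0.
  rewrite mulrBl mul1r /e -mulrA -yS {1}yE mulr_suml; apply/eqP.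
  by rewrite subr_eq0; apply/eqP/eq_bigr => i _; rewrite cP mulrA.
have em : 1 - e \notin loc_max p.
  apply/negP => em; have : e \in loc_max p by apply/piP; exists (\sum_i d i * c i).
  by move=> /(rpredD em); rewrite subrK idealr1.
have [v ve] := loc_unit em; have [yK0 _] := Qy K.+1; apply: yK0.
by rewrite -[y _]mul1r -ve -mulrA ye mulr0.
Qed.

End PrincipalMaximalIdeal.

Lemma locring_reduced (R : comNzRingType) (p : prime_idealr R) : reduced R -> reduced (locring p).
Proof.
move=> redR w n; have [a [s ->]] := rfracP w.
have -> : rfrac a s ^+ n = rfrac (a ^+ n) (iter n (denomM s) (denom1 p)).
  elim: n => [|n IH]; first by rewrite !expr0.
  by rewrite !exprS IH rfracM.
(* Exponent [n.+1] rather than [n], so that the power contains the factor [den u * a ^+ n] also when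
   [n] is 0. *)
move=> /rfrac_eq0[u ua]; apply/rfrac_eq0; exists u; apply: (redR _ n.+1).
have -> : (den u * a) ^+ n.+1 = den u ^+ n * a * (den u * a ^+ n).
  by rewrite exprMn !exprS; ring.
by rewrite ua mulr0.
Qed.

(** [N] has finitely many generators, and the product of their denominators works for all of [N]. *)
Lemma uniform_denom (R : comNzRingType) (p : prime_idealr R) (N N' : {pred R^o}) :
  noetherian R -> submod_closed N -> submod_closed N' ->
  (forall y, y \in N -> exists u : denom p, den u * y \in N') ->
  exists u : denom p, forall y, y \in N -> den u * y \in N'.
Proof.
move=> noethR clN clN' NN'; have [n [g gN]] := noethR N clN.
have /choice[u uP] i : exists u : denom p, den u * g i \in N'.
  exact/NN'/(generated_by_in i gN).
have N'Z (a x : R) : x \in N' -> a * x \in N'.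
  by move=> xN; rewrite -[_ * _]addr0; apply: clN'.2 => //; apply: clN'.1.
have up : \prod_i den (u i) \notin p.
  apply: (big_ind (fun a => a \notin p)) => [|a b ap bp|i _]; last exact: denP.
    by rewrite idealr1.
  by rewrite prime_idealrM negb_or ap.
exists (Denom up) => y /gN[c ->] /=; rewrite mulr_sumr.
apply: (big_ind (fun x => x \in N')) => [|x z xN zN|i _]; first exact: clN'.1.
  by rewrite -[x]mul1r; apply: clN'.2.
rewrite (bigD1 i) //= mulrCA; apply/N'Z; rewrite mulrAC mulrC; exact/N'Z/uP.
Qed.

(** * From regular local rings to hereditary rings *)

Section RegularHereditary.
Variable R : comNzRingType.
Hypotheses (noethR : noetherian R) (redR : reduced R) (dimR : krull_dim_eq R 1).

(** Chains of primes in R_p contract to R, so pR_p has at most one generator; if there is none, [pi]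
    is 0. *)
Lemma regular_loc_max_principal (p : prime_idealr R) : regular_local (locring p) ->
  exists pi : locring p, forall w, w \in loc_max p <-> exists c, w = c * pi.
Proof.
move=> [_ [m [d [g [[mmax _] [[q /contract_chain chq] _] mg]]]]].
have d1 : (d <= 1)%N := dimR.2 _ _ chq.
have mE w : (w \in loc_max p) = (w \in m).
  by have [_ uniq] := unique_loc_max p; rewrite (uniq m mmax).
case: d g d1 mg {chq q} => [|[|//]] g _ mg.
  exists 0 => w; rewrite mE; split=> [/mg[c ->]|[c ->]]; last by rewrite mulr0 idealr0.
  by exists 0; rewrite big_ord0 mulr0.
exists (g ord0) => w; rewrite mE; split=> [/mg[c ->]|[c ->]].
  by exists (c ord0); rewrite big_ord1.
by apply/mg; exists (fun=> c); rewrite big_ord1.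
Qed.

(** Nonzero elements of R_p are units times powers of [pi]; [x] is an element of [I] with least
    exponent. Statements about R_p are phrased in R by clearing denominators. *)
Lemma regular_loc_ideal_principal (p : prime_idealr R) (I : {pred R^o}) :
    regular_local (locring p) -> submod_closed I ->
  (forall y : R, y \in I -> exists u : denom p, den u * y = 0) \/
  exists x : R, [/\ x \in I,
    forall y : R, y \in I -> exists (u : denom p) (c : R), den u * y = c * x
    & forall a, a * x = 0 -> exists u : denom p, den u * a = 0].
Proof.
move=> regp clI; have [noethS _] := regp.
have [pi piP] := regular_loc_max_principal regp.
have [I0|/existsNP[y0 /not_implyP[y0I y00]]] :=
  pselect (forall y : R, y \in I -> exists u : denom p, den u * y = 0); [by left|right].
pose one := denom1 p.
have pw y : ~ (exists u : denom p, den u * y = 0) ->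
    exists (k : nat) (v : locring p), v \notin loc_max p /\ rfrac y one = v * pi ^+ k.
  by move=> y_n0; apply: unit_pi_power => // /rfrac_eq0.
pose P (k : nat) := `[< exists (y : R) (v : locring p),
  [/\ y \in I, v \notin loc_max p & rfrac y one = v * pi ^+ k] >].
have exP : exists k, P k.
  by have [k [v [vm yE]]] := pw _ y00; exists k; apply/asboolP; exists y0, v.
case: (ex_minnP exP) => k /asboolP[x [v [xI vm xE]]] kmin.
exists x; split=> // [y yI|a ax].
  have [[u uy]|/pw[l [w [wm yE]]]] := pselect (exists u : denom p, den u * y = 0).
    by exists u, 0; rewrite uy mul0r.
  have kl : (k <= l)%N by apply: kmin; apply/asboolP; exists y, w.
  have [v' v'v] := loc_unit vm.
  have : rfrac y one = (w * pi ^+ (l - k) * v') * rfrac x one.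
    rewrite yE xE -{1}(subnK kl) exprD; transitivity (w * pi ^+ (l - k) * pi ^+ k * (v' * v)).
      by rewrite v'v mulr1 mulrA.
    by ring.
  have [c [s ->]] := rfracP (w * pi ^+ (l - k) * v').
  rewrite rfracM => /fracE[u]; rewrite /GRing.scale /= !mulr1 mul1r => e.
  by exists (denomM u s), (den u * c); rewrite /= -mulrA e mulrA.
(* If [a] is nonzero in R_p, then a x = 0 makes a power of [pi] vanish, and reducedness forces [pi]
   to be 0. All exponents are then 0, so a product of units vanishes. *)
apply: contrapT => an; have := an => /pw[l [w [wm aE]]].
have : rfrac a one * rfrac x one = 0.
  by rewrite rfracM ax; apply/rfrac_eq0; exists one; rewrite mulr0.
have [[v' v'v] [w' w'w]] := (loc_unit vm, loc_unit wm).
rewrite aE xE => e; have pi0 : pi = 0.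
  apply: (locring_reduced redR (n := l + k)).
  transitivity (v' * w' * (w * pi ^+ l * (v * pi ^+ k))); last by rewrite e mulr0.
  transitivity ((v' * v) * (w' * w) * (pi ^+ l * pi ^+ k)); last by ring.
  by rewrite v'v w'w !mul1r exprD.
have exp0 b i (z : locring p) : ~ (exists u : denom p, den u * b = 0) ->
    rfrac b one = z * pi ^+ i -> i = 0%N.
  case: i => // i bn bE; case: bn; apply/rfrac_eq0.
  by apply: (etrans bE); rewrite pi0 expr0n mulr0.
(* [k] is compared with the exponent of [y0], which is known not to vanish in R_p. *)
have k0 : k = 0%N.
  have [k' [v0 [v0m y0E]]] := pw _ y00; apply/eqP; rewrite -leqn0.
  rewrite -(exp0 _ _ _ y00 y0E); apply: kmin; apply/asboolP; exists y0, v0; split=> //.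
move: e; rewrite k0 (exp0 _ _ _ an aE) !expr0 !mulr1 => wv0.
have : (1 : locring p) = w' * v' * (w * v).
  by rewrite mulrACA w'w v'v mulr1.
by rewrite wv0 mulr0; apply/eqP/oner_neq0.
Qed.

(** A local generator [x] of [I] gives a one-element dual basis once denominators are cleared
    uniformly. *)
Lemma regular_local_dual_basis (p : prime_idealr R) (I : {pred R^o}) :
    regular_local (locring p) -> submod_closed I ->
  exists (t : denom p) (x : R) (s : R^o -> R^o),
    [/\ x \in I, @linear_on R R^o R^o I s & forall y, y \in I -> den t * y = s y * x].
Proof.
move=> regp clI.
have cl0 : submod_closed (pred1 0 : {pred R^o}).
  by split=> [|a x y]; rewrite !inE // => /eqP-> /eqP->; rewrite scaler0 addr0.
have [I0|[x [xI Ix annx]]] := regular_loc_ideal_principal regp clI.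
  have [|u uI] := @uniform_denom R p I (pred1 0) noethR clI cl0.
    by move=> y /I0[u uy]; exists u; rewrite inE uy.
  exists u, 0, (fun=> 0); split=> [||y /uI]; first exact: clI.1.
    by move=> a y z _ _; rewrite scaler0 addr0.
  by rewrite inE mulr0 => /eqP.
pose Rx : {pred R^o} := fun y => `[< exists c, y = c * x >].
have clRx : submod_closed Rx.
  split=> [|c y z /asboolP[r ->] /asboolP[r' ->]]; apply/asboolP.
    by exists 0; rewrite mul0r.
  by exists (c * r + r'); rewrite mulrDl -mulrA.
pose ann : {pred R^o} := fun a => a * x == 0.
have clann : submod_closed ann.
  split=> [|c y z]; rewrite !unfold_in ?mul0r // => /eqP yx /eqP zx.
  by rewrite mulrDl zx addr0 -[_ *: _]/(c * (y : R)) -mulrA yx mulr0.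
have [|u uI] := @uniform_denom R p I Rx noethR clI clRx.
  by move=> y /Ix[u [c uy]]; exists u; apply/asboolP; exists c.
have [|t tann] := @uniform_denom R p ann (pred1 0) noethR clann cl0.
  by move=> a /eqP/annx[t ta]; exists t; rewrite inE ta.
have /choice[r rP] y : exists c, y \in I -> den u * y = c * x.
  by have [/uI/asboolP[c uy]|_] := boolP (y \in I); [exists c|exists 0].
(* [r] is merely chosen, so it is linear only up to the annihilator of [x]; the factor [t] kills
   that annihilator. *)
exists (denomM t u), x, (fun y => den t * r y); split=> // [a y z yI zI|y yI] /=.
  apply/eqP; rewrite -subr_eq0; apply/eqP.
  have ayz : a *: y + z \in I by apply: clI.2.
  have : r (a *: y + z) - (a * r y + r z) \in ann.
    rewrite unfold_in mulrBl mulrDl -mulrA -!rP // -[a *: y]/(a * (y : R)).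
    by apply/eqP; ring.
  move=> /tann/eqP tr; rewrite -[RHS]tr /GRing.scale /=; ring.
by rewrite -mulrA rP // mulrA.
Qed.

(** The [t] whose multiplication on [I] has a finite dual-basis expansion form an ideal [T]. The
    local dual basis at [p] puts an element outside [p] into [T]; so no prime contains [T], and 1
    lies in it. *)
Lemma regular_hereditary : regular R -> hereditary R.
Proof.
move=> [_ regR] I clI.
pose T : {pred R} := fun t => `[< exists (J : finType) (s : J -> R^o -> R) (g : J -> R),
  [/\ forall j, @linear_on R R^o R^o I (s j), forall j, g j \in I
    & forall y, y \in I -> t * y = \sum_j s j y * g j] >].
have [/asboolP[J [s [g [s_lin gI gE]]]]|T1] := boolP (1 \in T).
  by exists J, s, g; split=> // y yI; rewrite -[LHS]mul1r gE.
have clT : idealr_closed T.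
  split=> //.
    apply/asboolP; exists 'I_0, (fun _ _ => 0), (fun=> 0); split=> [[]//|[]//|y _].
    by rewrite big_ord0 mul0r.
  move=> a t t' /asboolP[J [s [g [s_lin gI gE]]]] /asboolP[J' [s' [g' [s'_lin g'I g'E]]]].
  apply/asboolP; exists (J + J')%type,
    (fun j y => match j with inl j => a * s j y | inr j => s' j y end),
    (fun j => match j with inl j => g j | inr j => g' j end); split=> [[]j|[]//|y yI].
  - move=> c y z yI zI; rewrite (s_lin j) //.
    by rewrite mulrDr -[c *: _]/(c * _) -[c *: _]/(c * _) mulrCA.
  - exact: s'_lin.
  rewrite big_sumType /= mulrDl -mulrA gE // g'E // mulr_sumr; congr (_ + _).
  by apply: eq_bigr => j _; rewrite mulrA.
have [p Tp] := exists_prime_over (mk_ideal clT).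
have [t [x [s [xI s_lin sE]]]] := regular_local_dual_basis (regR p) clI.
have /Tp : den t \in T.
  apply/asboolP; exists 'I_1, (fun=> s), (fun=> x); split=> // y yI.
  by rewrite big_ord1 sE.
by rewrite (negPf (denP t)).
Qed.

End RegularHereditary.

(** * The module R and its endomorphism ring *)

Section RegularModule.
Variable R : comNzRingType.
Local Notation A := (endo R^o)^c.

Lemma endo_homothety (f : A^o) : f = homothety R^o ((f : endo R^o) 1).
Proof. by apply: endoP => x; rewrite -[x in LHS]mulr1 linearZ /=; apply: mulrC. Qed.

(** Evaluation at 1 identifies End(R) with R; ideals and dual bases are transported along
    homotheties. *)
Lemma endo_hereditary : hereditary R -> hereditary A.
Proof.
move=> hR L clL; pose I : {pred R^o} := fun a => homothety R^o a \in L.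
have inI a : (a \in I) = (homothety R^o a \in L) by [].
have hD (a b c : R) : homothety R^o (a * b + c) =
    (homothety R^o a : A) *: homothety R^o b + homothety R^o c.
  by apply: endoP => x; rewrite /= mulrC scalerDl -!scalerA.
have clI : submod_closed I.
  split=> [|a b c bI cI]; rewrite inI.
    rewrite (_ : homothety _ 0 = 0); first exact: clL.1.
    by apply: endoP => x; apply: scale0r.
  by rewrite -[a *: b]/(a * (b : R)) hD; apply: clL.2.
have [J [s [g [s_lin gI gE]]]] := hR I clI.
exists J, (fun j (f : A^o) => homothety R^o (s j ((f : endo R^o) 1)) : A),
  (fun j => homothety R^o (g j)); split=> [j a x y xL yL|j|x xL].
- rewrite [a in RHS]endo_homothety -[RHS]hD; congr (homothety _ _).
  have xI : (x : endo R^o) 1 \in I by rewrite inI -endo_homothety.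
  have yI : (y : endo R^o) 1 \in I by rewrite inI -endo_homothety.
  rewrite -[RHS]s_lin //; congr (s j _).
  rewrite {1}[a]endo_homothety [x in LHS]endo_homothety /=.
  by rewrite /GRing.scale /= !mulr1 mulrC.
- by rewrite -inI.
have xI : (x : endo R^o) 1 \in I by rewrite inI -endo_homothety.
rewrite {1}[x]endo_homothety {1}(gE _ xI).
apply: (big_ind2 (fun a f => homothety R^o a = f)) => [|a f b f' <- <-|j _].
- by apply: endoP => y; apply: scale0r.
- by apply: endoP => y; apply: scalerDl.
- by apply: endoP => y; rewrite /= scalerA mulrC.
Qed.

(* If A were of global dimension 0, then R/p1 would be projective, and lifting the
   identity of R/p1 would give f with 1 - f in p1 and p1 f = 0. *)
Lemma endo_gldim_neq0 : krull_dim_eq R 1 -> ~ gldim_le A 0.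
Proof.
move=> [[q /(_ 0%N isT)[q01 /existsNP[x /not_implyP[xq1 xq0]]]] _] gl0.
pose L : {pred A^o} := fun f => (f : endo R^o) 1 \in q 1%N.
have clL : submod_closed L.
  split=> [|a f g fL gL]; first exact: idealr0.
  rewrite -[_ \in _]/((f : endo R^o) ((a : endo R^o) 1) + (g : endo R^o) 1 \in q 1%N).
  rewrite rpredD // -[(a : endo R^o) 1]mulr1 linearZ; exact: idealMr.
pose Q : lmodType A := quotient_module clL.
pose pr : {linear A^o -> Q} := quotient_map clL.
have pr_surj : surj pr by apply: quotient_mapP.
have [h hP] := gldim_le0_projective gl0 (idfun : {linear Q -> Q}) pr_surj.
pose f := h (pr 1).
have fL : 1 - f \in L.
  apply/(quotient_map_eq0 clL); have := linearB pr 1 f; rewrite hP subrr; exact.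
have : (homothety R^o x : A) *: f = 0.
  rewrite -linearZ -linearZ /= (_ : pr _ = 0) ?linear0 //.
  apply/(quotient_map_eq0 clL).
  by rewrite -[_ \in _]/(x * 1 \in q 1%N) mulr1.
move=> /(congr1 (fun g : A^o => (g : endo R^o) 1)) /= e.
have xf : x * (f : endo R^o) 1 = 0 by move: e; rewrite linearZ.
(* Primality of [q 0] puts f(1) in [q 0], hence in [q 1]; as [1 - f] is in [L], 1 would lie in
   [q 1]. *)
have : x * (f : endo R^o) 1 \in q 0%N by rewrite xf idealr0.
rewrite prime_idealrM (negPf (introN idP xq0)) /= => /q01 fq1.
by have := rpredD fL fq1; rewrite subrK idealr1.
Qed.

Lemma regular_module_generator : generator (R^o : lmodType R).
Proof.
have lin_f : linear (fun x : R^o * 'rV[R]_0 => [ffun _ : 'I_1 => x.1]).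
  by move=> a x y; apply/ffunP => i; rewrite !ffunE.
exists 1%N, 'rV[R]_0, (mk_linear lin_f); exists (fun v : {ffun 'I_1 -> R^o} => (v ord0, 0)).
  by move=> [x y]; rewrite /= ffunE; congr (_, _); apply/rowP => -[].
by move=> v; apply/ffunP => i; rewrite (ord1 i) ffunE.
Qed.

Lemma regular_module_finitely_generated : finitely_generated (R^o : lmodType R).
Proof. by exists 1%N, (fun=> 1) => x; exists (fun=> x); rewrite big_ord1 [RHS]mulr1. Qed.

End RegularModule.

Theorem proposition3p2 (R : comNzRingType) :
  noetherian R -> reduced R -> krull_dim_eq R 1%N ->
  ((exists M : lmodType R,
      [/\ generator M, gives_NCR M & gldim_eq (endo M)^c 1%N])
   <-> regular R).
Proof.
move=> noethR redR dimR; split=> [[M [genM _ [gl1 _]]]|regR].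
  have hR := generator_hereditary noethR genM gl1.
  by split=> // p; apply: hereditary_regular_local.
have gl1 : gldim_le (endo R^o)^c 1.
  exact/hereditary_gldim_le1/endo_hereditary/regular_hereditary.
exists R^o; split; first exact: regular_module_generator.
  by split=> //; [apply: regular_module_finitely_generated | exists 1%N].
(* The only bound below 1 is 0, which the strict inclusion of primes rules out. *)
by split=> // -[gl0|//]; case: (endo_gldim_neq0 dimR).
Qed.
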